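(* Let $\mathcal{P}_g$ be the family of planar graphs having girth at least $g$. Then the game $BS_n(\mathcal{P}_g : t_1, t_2, \dots, t_n)$ ends exactly after $n-1$ moves for all $g \geq 2n+1$.
   Context: The girth of a graph is the length of a shortest cycle (infinite if there is no cycle). A set of graphs $\mathcal{F}$ is a hereditary class if every graph isomorphic to an induced subgraph of a graph in $\mathcal{F}$ belongs to $\mathcal{F}$. For a hereditary class $\mathcal{F}$, the game $BS_n(\mathcal{F}:t_1,\dots,t_n)$ ($n$-Brussels sprout for $\mathcal{F}$ with parameters $(t_1,\dots,t_n)$) is the following two-player pen and paper game. It starts with $n$ spots having $t_1, \dots, t_n$ open tips (free partial edges coming out of the spot), respectively. The players move alternately. A valid move consists of joining two open tips with a curve, followed by drawing a crossbar on the curve to create two new open tips. The graph obtained by taking the spots and the intersections of a curve and a crossbar as vertices, and the curves joining two such vertices as edges, must remain inside the family $\mathcal{F}$ at all times. The first player unable to provide a valid move loses. The number of moves is the total number of moves made by both players.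
   Formalization: Every spot is assumed to have at least one open tip (all t_i ≥ 1, with n ≥ 1); if some t_i = 0 the claim fails, e.g. for n = 2 and t = (0,0) no move is possible, so the game ends after 0 moves instead of 1. *)

(* Defs.v *)
(* The plane is R * R, with the product topology, for an arbitrary realType R. *)
From HB Require Import structures.
From mathcomp Require Import all_boot all_order all_algebra.
From mathcomp Require Import all_classical all_reals all_analysis.

Set Implicit Arguments.
Unset Strict Implicit.
Unset Printing Implicit Defensive.

Import Order.TTheory GRing.Theory Num.Theory.
Import numFieldNormedType.Exports.

Local Open Scope classical_set_scope.
Local Open Scope ring_scope.

(* Parallel edges have to be recorded: joining two open tips of the same vertex
   creates a pair of parallel edges, that is, a cycle of length 2. *)
Record mgraph := MGraph {
  vertex :> finType;
  edge : finType;
  ends : edge -> vertex * vertex (* unordered: only used through [joins] *)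
}.

Definition joins (G : mgraph) (e : edge G) (u v : G) : bool :=
  (ends e == (u, v)) || (ends e == (v, u)).

(* k = 1 is a loop, k = 2 a pair of parallel edges. *)
Definition has_cycle (G : mgraph) (k : nat) : Prop :=
  (0 < k)%N /\
  exists (v : 'I_k -> G) (e : 'I_k -> edge G),
    [/\ injective v, injective e & forall i, joins (e i) (v i) (v (ordS i))].

(* The infimum of the empty set is +oo. *)
Definition girth (R : realType) (G : mgraph) : \bar R :=
  ereal_inf [set k%:R%:E | k in has_cycle G].

Record is_plane_drawing (R : realType) (G : mgraph)
    (pos : G -> R * R) (arc : edge G -> R -> R * R) : Prop := IsPlaneDrawing {
  drawing_pos_inj : injective pos;
  drawing_continuous : forall e, {within `[0, 1], continuous (arc e)};
  drawing_ends : forall e, exists u v,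
    [/\ joins e u v, arc e 0 = pos u & arc e 1 = pos v];
  drawing_avoids_pos : forall e s v, s \in `]0, 1[ -> arc e s != pos v;
  (* e = e': no self-intersection (the endpoints may coincide, for a loop);
     e <> e': distinct arcs only meet at vertices. *)
  drawing_no_crossing : forall e e' s s', s \in `]0, 1[ -> s' \in `]0, 1[ ->
    arc e s = arc e' s' -> e = e' /\ s = s'
}.

Definition planar (R : realType) (G : mgraph) : Prop :=
  exists pos arc, @is_plane_drawing R G pos arc.

Definition miso (G H : mgraph) : Prop :=
  exists (f : G -> H) (h : edge G -> edge H),
    [/\ bijective f, bijective h
      & forall e u v, joins (h e) (f u) (f v) = joins e u v].

Section Induced.
Variables (G : mgraph) (A : {set G}).

Definition induced_edge : finType :=
  {e : edge G | ((ends e).1 \in A) && ((ends e).2 \in A)}.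

Definition induced_ends (e : induced_edge) : {x | x \in A} * {x | x \in A} :=
  (Sub (ends (val e)).1 (proj1 (andP (valP e))),
   Sub (ends (val e)).2 (proj2 (andP (valP e)))).

Definition induced : mgraph := MGraph induced_ends.
End Induced.

Definition hereditary (F : mgraph -> Prop) : Prop :=
  forall (G : mgraph) (A : {set G}) (H : mgraph),
    F G -> miso (induced A) H -> F H.

Record hereditary_class := HereditaryClass {
  class_mem :> mgraph -> Prop;
  class_hereditary : hereditary class_mem
}.

Section PlanarGirth.
Variable R : realType.

Lemma joins_induced (G : mgraph) (A : {set G}) (e : edge (induced A))
    (u v : induced A) : joins e u v = joins (val e) (val u) (val v).
Proof.
by rewrite /joins !(inj_eq val_inj, xpair_eqE) /= -!val_eqE /=
  [ends (val e)]surjective_pairing !xpair_eqE.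
Qed.

(* A common generalization of [induced] and [miso]. *)
Lemma planar_emb (G H : mgraph) (f : H -> G) (h : edge H -> edge G) :
  injective f -> injective h ->
  (forall e u v, joins e u v = joins (h e) (f u) (f v)) ->
  planar R G -> planar R H.
Proof.
move=> finj hinj fh [pos [arc [pinj cont dends avoid nocross]]].
exists (pos \o f), (arc \o h); split=> [u v /pinj/finj //|e|e|e s v|].
- exact: cont.
- have [u [v [huv a0 a1]]] := dends (h e).
  have : joins e (ends e).1 (ends e).2.
    by rewrite /joins -surjective_pairing eqxx.
  case: (ends e) => a b /= eab; have := eab; rewrite fh /joins.
  case/orP: huv => /eqP huv; rewrite huv !xpair_eqE.
  + case/orP=> /andP[/eqP ua /eqP vb].
      by exists a, b; rewrite a0 a1 /= ua vb.
    by exists b, a; rewrite /= a0 a1 ua vb /joins orbC.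
  + case/orP=> /andP[/eqP ua /eqP vb].
      by exists b, a; rewrite /= a0 a1 ua vb /joins orbC.
    by exists a, b; rewrite a0 a1 /= ua vb.
- exact: avoid.
- by move=> e e' s s' hs hs' /(nocross _ _ _ _ hs hs')[/hinj-> ->].
Qed.

Lemma girth_emb (G H : mgraph) (f : H -> G) (h : edge H -> edge G) :
  injective f -> injective h ->
  (forall e u v, joins e u v = joins (h e) (f u) (f v)) ->
  (girth R G <= girth R H)%E.
Proof.
move=> finj hinj fh; apply: ereal_inf_le_tmp => _ [k [k0 [v [e [vi ei vev]]]] <-].
exists k => //; split=> //; exists (f \o v), (h \o e); split.
- exact: inj_comp.
- exact: inj_comp.
- by move=> i; rewrite /= -fh.
Qed.

Definition planar_girth_ge (g : nat) (G : mgraph) : Prop :=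
  planar R G /\ (g%:R%:E <= girth R G)%E.

Lemma planar_girth_ge_hereditary g : hereditary (planar_girth_ge g).
Proof.
move=> G A H [plG gG] [f [h [[f' fK f'K] [h' hK h'K] fh]]].
have i1 : injective (val \o f') by apply: inj_comp val_inj (can_inj f'K).
have i2 : injective (val \o h') by apply: inj_comp val_inj (can_inj h'K).
have jn (e : edge H) (u v : H) :
    joins e u v = joins ((val \o h') e) ((val \o f') u) ((val \o f') v).
  by rewrite /= -joins_induced -fh h'K !f'K.
split; first exact: planar_emb i1 i2 jn plG.
exact: le_trans gG (girth_emb i1 i2 jn).
Qed.

Definition P_ (g : nat) : hereditary_class :=
  HereditaryClass (@planar_girth_ge_hereditary g).
End PlanarGirth.

(* A position is the current graph with the number of open tips at each vertex;
   the tips at a given vertex are interchangeable. *)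
Record position := Position {
  board :> mgraph;
  tips : board -> nat
}.

Section Join.
Variables (p : position) (u v : p).

(* The number of tips at x used by a curve from a tip at u to a tip at v; it is
   2 if u = v = x, so that the two tips joined are always distinct. *)
Definition tips_used (x : p) : nat := ((x == u) + (x == v))%N.

Definition joinable : Prop := forall x, (tips_used x <= tips x)%N.

(* The new vertex None is the intersection of the curve and the crossbar; the
   new edges are the two halves of the curve. *)
Definition join_ends (e : edge p + bool) : option p * option p :=
  match e with
  | inl e => (Some (ends e).1, Some (ends e).2)
  | inr true => (Some u, None)
  | inr false => (Some v, None)
  end.

Definition join_tips (x : option p) : nat :=
  if x is Some x then (tips x - tips_used x)%N else 2.

Definition join : position := @Position (MGraph join_ends) join_tips.
End Join.

Definition valid_move (F : hereditary_class) (p q : position) : Prop :=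
  exists u v : p, [/\ joinable u v, q = join u v & F q].

Record game := Game {
  state : Type;
  start : state;
  move : state -> state -> Prop
}.

Definition spots (n : nat) (t : 'I_n -> nat) : position :=
  @Position (@MGraph 'I_n void (of_void _)) t.

Definition BS (n : nat) (F : hereditary_class) (t : 'I_n -> nat) : game :=
  Game (spots t) (valid_move F).

Inductive play (B : game) : nat -> state B -> Prop :=
| play_start : play 0 (start B)
| play_move k p q : play k p -> move p q -> play k.+1 q.

Definition terminal (B : game) (p : state B) : Prop := forall q, ~ move p q.

(* The first clause bounds the length of every play, so that there is no
   infinite play and every play extends to one which reaches a terminal state. *)
Definition ends_after (B : game) (m : nat) : Prop :=
  (forall k (p : state B), play k p -> (k <= m)%N) /\
  (forall k (p : state B), play k p -> terminal p -> k = m).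

(* Main.v *)
(* While the graph is a forest, a move inside one component closes a cycle on
   at most 2n vertices, which the girth condition forbids; a move between two
   components keeps the graph a forest, hence planar and acyclic. So every play
   stays among forests and each move decreases the number of components by one.
   Every component keeps an open tip, since a move creates two of them, so a
   move exists as long as there are two components. *)
Require Import Defs.
From mathcomp Require Import all_boot all_algebra all_reals.
From mathcomp Require Import all_order all_classical all_analysis lra zify.

Set Implicit Arguments.
Unset Strict Implicit.
Unset Printing Implicit Defensive.

Import Order.TTheory GRing.Theory Num.Theory.
Import numFieldNormedType.Exports.

(** * Incidence and adjacency in multigraphs *)

Lemma joinsC (G : mgraph) (e : edge G) u v : joins e u v = joins e v u.
Proof. by rewrite /joins orbC. Qed.

Lemma joins_ends (G : mgraph) (e : edge G) : joins e (ends e).1 (ends e).2.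
Proof. by rewrite /joins -surjective_pairing eqxx. Qed.

Lemma joins_inj (G : mgraph) (e : edge G) a b x y :
  joins e a b -> joins e x y -> (x = a /\ y = b) \/ (x = b /\ y = a).
Proof.
rewrite /joins => /orP[]/eqP->; rewrite !xpair_eqE;
  by case/orP=> /andP[/eqP-> /eqP->]; auto.
Qed.

Definition adj (G : mgraph) : rel G := fun x y => [exists e, joins e x y].

Lemma adj_sym (G : mgraph) : symmetric (@adj G).
Proof. by move=> x y; apply: eq_existsb => e; rewrite joinsC. Qed.

Lemma connect_adjC (G : mgraph) : connect_sym (@adj G).
Proof. exact/sym_connect_sym/adj_sym. Qed.

(* The forests in which the component of r is rooted at r: [up e] is the child
   and [lo e] the parent. *)
Record is_rooted (G : mgraph) (r : G) (depth : G -> nat)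
    (lo up : edge G -> G) : Prop := IsRooted {
  rooted_joins : forall e, joins e (lo e) (up e);
  rooted_depth : forall e, depth (up e) = (depth (lo e)).+1;
  rooted_inj : injective up;
  rooted_root : forall e, up e != r
}.

Definition rooted (G : mgraph) (r : G) : Prop :=
  exists depth lo up, @is_rooted G r depth lo up.

(** A deepest vertex of a cycle is the child end of both its cycle edges. As [up] is injective these
    coincide, so the cycle is a loop, which [rooted_depth] forbids. *)
Lemma rooted_acyclic (G : mgraph) (r : G) k : rooted r -> ~ has_cycle G k.
Proof.
move=> [depth [lo [up [jn dE upI _]]]] [k0 [v [e [_ eI ve]]]].
pose i0 := Ordinal k0.
case: (@arg_maxnP _ i0 xpredT (depth \o v) isT) => i _ /= imax.
have upE j x : joins (e j) (v x) (v i) -> up (e j) = v i.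
  move=> /(joins_inj (jn _))[[_ ->] //|[xE iE]].
  by have := imax x isT; rewrite xE iE dE ltnn.
have iS : up (e i) = v i by apply: (upE _ (ordS i)); rewrite joinsC ve.
have iP : up (e (ord_pred i)) = v i.
  by apply: (upE _ (ord_pred i)); have := ve (ord_pred i); rewrite ord_predK.
have /eI iPE : e i = e (ord_pred i) by apply: upI; rewrite iS iP.
have := ve i; rewrite {3}iPE ord_predK => /(joins_inj (jn _))[][->] /esym lu;
  by have := dE (e i); rewrite lu => /n_Sn.
Qed.

(** * Layered straight-line drawing of a rooted forest *)

Section RootedPlanar.
Variables (R : realType) (G : mgraph) (r : G) (depth : G -> nat).
Variables (lo up : edge G -> G).
Hypothesis rooted_r : is_rooted r depth lo up.

(* The abscissa of a vertex lists, in base #|G|, the vertices on the path which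
   leads to it from its root, so that on each level the children are ordered as
   their parents. *)
Fixpoint abscissa_rec (d : nat) (v : G) : nat :=
  if d is d'.+1 then
    if [pick e | up e == v] is Some e
    then (abscissa_rec d' (lo e) * #|G| + enum_rank v)%N else enum_rank v
  else enum_rank v.

(** Each step to a parent lowers the depth by one, so [depth v] is enough fuel. *)
Definition abscissa v := abscissa_rec (depth v) v.

Lemma abscissa_up e :
  abscissa (up e) = (abscissa (lo e) * #|G| + enum_rank (up e))%N.
Proof.
rewrite /abscissa (rooted_depth rooted_r) /=.
by case: pickP => [e' /eqP/(rooted_inj rooted_r)->|/(_ e)/eqP].
Qed.

(** The last digit of [abscissa v] in base [#|G|] is the rank of [v]. *)
Lemma abscissa_inj : injective abscissa.
Proof.
move=> u v uv; apply/enum_rank_inj/ord_inj.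
have E w : (abscissa w %% #|G|)%N = enum_rank w.
  rewrite /abscissa; case: (depth w) => [|d] /=; first by rewrite modn_small.
  by case: pickP => *; rewrite ?modnMDl modn_small.
by rewrite -!E uv.
Qed.

(** A gap of one between the parents becomes a gap of [#|G|], which the last digits cannot undo. *)
Lemma abscissa_mono e e' :
  (abscissa (lo e) < abscissa (lo e'))%N ->
  (abscissa (up e) < abscissa (up e'))%N.
Proof.
rewrite !abscissa_up => lt; apply: ltn_addr.
apply: leq_trans (leq_mul lt (leqnn #|G|)).
by rewrite mulSn addnC ltn_add2r ltn_ord.
Qed.

Local Open Scope ring_scope.
Local Open Scope classical_set_scope.

Lemma nat_frac_inj (a b : nat) (s s' : R) : 0 <= s < 1 -> 0 <= s' < 1 ->
  a%:R + s = b%:R + s' -> a = b.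
Proof.
move=> hs hs' ab.
have lt1 (c d : nat) (x y : R) : 0 <= x -> y < 1 ->
      c%:R + x = d%:R + y -> (c <= d)%N.
  move=> x0 y1 E; rewrite -ltnS -(ltr_nat R) -natr1; lra.
apply/eqP; rewrite eqn_leq; apply/andP; split.
  by apply: lt1 ab; lra.
by apply: lt1 (esym ab); lra.
Qed.

Definition rooted_pos (v : G) : R * R := ((abscissa v)%:R, (depth v)%:R).

(** Parent and child are one level apart, so this is a segment parametrized by its height above the
    parent. *)
Definition rooted_arc (e : edge G) (s : R) : R * R :=
  ((abscissa (lo e))%:R * (1 - s) + (abscissa (up e))%:R * s,
   (depth (lo e))%:R + s).

(** The children are ordered as their parents, and so are convex combinations with the same weights.
    With equal parents, [s > 0] forces equal children. *)
Lemma rooted_no_crossing e e' s :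
  0 < s < 1 -> rooted_arc e s = rooted_arc e' s -> e = e'.
Proof.
move=> /andP[s0 s1].
have lt e1 e2 : rooted_arc e1 s = rooted_arc e2 s ->
    ~ (abscissa (lo e1) < abscissa (lo e2))%N.
  move=> [E _] l12; have u12 := abscissa_mono l12; move: l12 u12.
  rewrite -(ltr_nat R) -subr_gt0 => l12; rewrite -(ltr_nat R) -subr_gt0 => u12.
  have s1' : 0 < 1 - s by lra.
  have := mulr_gt0 l12 s1'; have := mulr_gt0 u12 s0; lra.
move=> E; have [/(lt _ _ E)//|/(lt _ _ (esym E))//|loE] :=
  ltngtP (abscissa (lo e)) (abscissa (lo e')).
apply/(rooted_inj rooted_r)/abscissa_inj/eqP; rewrite -(eqr_nat R); apply/eqP.
case: E => + _; rewrite loE => /addrI/mulIf; apply; exact: lt0r_neq0.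
Qed.

Lemma rooted_planar : planar R G.
Proof.
exists rooted_pos, rooted_arc; split.
- by move=> u v [/eqP]; rewrite eqr_nat => /eqP/abscissa_inj.
- move=> e; apply: continuous_subspaceT => s.
  have cx : {for s, continuous (fun s => (rooted_arc e s).1)}.
    apply: cvgD; apply: cvgM; try exact: cvg_cst; last exact: cvg_id.
    by apply: cvgB; [exact: cvg_cst|exact: cvg_id].
  have cy : {for s, continuous (fun s => (rooted_arc e s).2)}.
    by apply: cvgD; [exact: cvg_cst|exact: cvg_id].
  exact: cvg_pair cx cy.
- move=> e; exists (lo e), (up e); split; first exact: rooted_joins rooted_r e.
    by rewrite /rooted_arc /rooted_pos subr0 mulr1 mulr0 !addr0.
  rewrite /rooted_arc /rooted_pos subrr mulr1 mulr0 add0r.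
  by rewrite (rooted_depth rooted_r) natr1.
- move=> e s v; rewrite in_itv /= => /andP[s0 s1].
  (* Vertices have integer height, interior points of arcs do not. *)
  apply/eqP => -[_]; rewrite -[RHS]addr0 => E.
  have ab : depth (lo e) = depth v by apply: nat_frac_inj E; lra.
  by move: E; rewrite ab => /addrI s00; rewrite s00 ltxx in s0.
- move=> e e' s s'; rewrite !in_itv /= => hs hs' E.
  have [_ yE] := E.
  have ab : depth (lo e) = depth (lo e') by apply: nat_frac_inj yE; lra.
  move: yE; rewrite ab => /addrI ss; subst s'; split=> //.
  exact: rooted_no_crossing E.
Qed.

End RootedPlanar.

(** Without cycles the girth is infinite, whatever [g] is. *)
Lemma rooted_mem (R : realType) g (G : mgraph) (r : G) : rooted r -> P_ R g G.
Proof.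
move=> rr; split; first by have [? [? [? h]]] := rr; exact: rooted_planar h.
by apply: le_ereal_inf_tmp => _ [k kc <-]; have := rooted_acyclic rr kc.
Qed.

(* Root A at r if it contains r, else at u, and its complement at r if it
   contains r, else at v; a side without r then hangs from the new vertex. *)
Lemma rooted_join (p : position) (u v : p) (A : {pred p}) :
  (forall e a b, joins e a b -> (a \in A) = (b \in A)) ->
  u \in A -> v \notin A -> (forall r : p, rooted r) ->
  forall r : join u v, rooted r.
Proof.
move=> AE uA vA rt r.
pose rA := if r is Some x then x \in A else false.
pose rB := if r is Some x then x \notin A else false.
have rAB : ~~ (rA && rB) by rewrite /rA /rB; case: (r) => //= x; rewrite andbN.
have [a a_r a_u] : exists2 a, rA -> r = Some a & ~~ rA -> a = u.
  rewrite /rA; case: (r) => [x|]; last by exists u.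
  by case: (boolP (x \in A)); [exists x|exists u].
have [b b_r b_v] : exists2 b, rB -> r = Some b & ~~ rB -> b = v.
  rewrite /rB; case: (r) => [x|]; last by exists v.
  by case: (boolP (x \notin A)); [exists x|exists v].
have [dA [loA [upA [jA deA iA nA]]]] := rt a.
have [dB [loB [upB [jB deB iB nB]]]] := rt b.
pose eA (e : edge p) := (ends e).1 \in A.
have eAE e x y : joins e x y -> (x \in A = eA e) * (y \in A = eA e).
  move=> h; rewrite -(AE _ _ _ h); suff : x \in A = eA e by [].
  by have [[-> _]|[-> _]] := joins_inj (joins_ends e) h;
    rewrite // /eA (AE _ _ _ (joins_ends e)).
pose up (e : edge (join u v)) : join u v := match e with
  | inl e => Some (if eA e then upA e else upB e)
  | inr true => if rA then None else Some u
  | inr false => if rB then None else Some v end.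
pose lo (e : edge (join u v)) : join u v := match e with
  | inl e => Some (if eA e then loA e else loB e)
  | inr true => if rA then Some u else None
  | inr false => if rB then Some v else None end.
(* The shifts make the depth of [u] differ by one from that of [None]: smaller if [r] is in [A],
   larger otherwise. Likewise for [v] on the other side. *)
pose depth (x : join u v) : nat := match x with
  | Some x => if x \in A then dA x + dB v + 2 * ~~ rA
              else dB x + dA u + 2 * ~~ rB
  | None => (dA u + dB v).+1 end.
exists depth, lo, up; split.
- case=> [e|[]] /=; rewrite /joins /=.
  + have : joins e (if eA e then loA e else loB e)
                   (if eA e then upA e else upB e).
      by case: ifP.
    by rewrite /joins => /orP[]/eqP->; rewrite eqxx ?orbT.
  + by case: (rA); rewrite eqxx ?orbT.
  + by case: (rB); rewrite eqxx ?orbT.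
- case=> [e|[]] /=.
  + case he: (eA e).
      by rewrite !(eAE _ _ _ (jA e)) he deA.
    by rewrite !(eAE _ _ _ (jB e)) he deB.
  + by case: ifP => h; rewrite /= uA h /=; lia.
  + by case: ifP => h; rewrite /= (negbTE vA) h /=; lia.
(* On a side without [r], the root is [u] or [v], hence the child of no old edge. *)
- have upu e : ~~ rA -> up (inl e) <> Some u.
    move=> /a_u au []; case: ifP => he E.
      by have := nA e; rewrite E au eqxx.
    by have := (eAE _ _ _ (jB e)).2; rewrite E uA he.
  have upv e : ~~ rB -> up (inl e) <> Some v.
    move=> /b_v bv []; case: ifP => he E.
      by have := (eAE _ _ _ (jA e)).2; rewrite E (negbTE vA) he.
    by have := nB e; rewrite E bv eqxx.
  have uv : u <> v by move=> E; rewrite -E uA in vA.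
  have inlI e e' : up (inl e) = up (inl e') -> e = e'.
    move=> -[]; case: ifP => he; case: ifP => he' E; [exact: iA| | |exact: iB].
      by have := eAE _ _ _ (jA e); rewrite E !(eAE _ _ _ (jB e')) he' he; case.
    by have := eAE _ _ _ (jB e); rewrite E !(eAE _ _ _ (jA e')) he' he; case.
  have upNu e : up (inl e) <> up (inr true).
    by rewrite [up (inr _)]/=; case: ifP => // /negbT/upu.
  have upNv e : up (inl e) <> up (inr false).
    by rewrite [up (inr _)]/=; case: ifP => // /negbT/upv.
  (* [None] is the child of at most one half, as [r] lies on at most one side. *)
  have upN : up (inr true) <> up (inr false).
    by move: rAB => /=; case: (rA); case: (rB) => //= _ [].
  move=> [e|[]] [e'|[]] // E; try by [case: (upN)|case: (upN); rewrite E].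
  + by rewrite (inlI _ _ E).
  + by case: (upNu e).
  + by case: (upNv e).
  + by case: (upNu e').
  + by case: (upNv e').
- case=> [e|[]] /=; apply/eqP.
  + case: ifP => he E.
      have hA : rA by rewrite /rA -E (eAE _ _ _ (jA e)).
      by move: E (nA e); rewrite (a_r hA) => -[->]; rewrite eqxx.
    have hB : rB by rewrite /rB -E (eAE _ _ _ (jB e)) he.
    by move: E (nB e); rewrite (b_r hB) => -[->]; rewrite eqxx.
  + by case: ifPn => [/a_r -> //|+ E]; rewrite /rA -E uA.
  + by case: ifPn => [/b_r -> //|+ E]; rewrite /rB -E vA.
Qed.

(** * Cycles created by a move *)

Lemma has_cycle_leq (G : mgraph) k : has_cycle G k -> (k <= #|G|)%N.
Proof. by move=> [_ [v [e [/leq_card + _ _]]]]; rewrite card_ord. Qed.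

(** Translates [next] into the [ordS] of [has_cycle]. *)
Lemma next_nth_modn (T : eqType) (x0 : T) (c : seq T) i :
  uniq c -> (i < size c)%N ->
  next c (nth x0 c i) = nth x0 c (i.+1 %% size c).
Proof.
move=> uc ic; rewrite next_nth mem_nth // index_uniq //.
case: c uc ic => // y c _; rewrite ltnS leq_eqVlt => /orP[/eqP->|ic].
  by rewrite modnn nth_default.
by rewrite modn_small //=; exact: set_nth_default.
Qed.

(* The adjacency relation forgets multiplicities, whence the bound on the
   size. *)
Lemma ucycle_has_cycle (G : mgraph) (c : seq G) :
  (2 < size c)%N -> ucycle (@adj G) c -> has_cycle G (size c).
Proof.
move=> c2 /andP[cc uc].
have /hasP[x0 _ _] : has predT c by rewrite has_predT; lia.
pose v (i : 'I_(size c)) := nth x0 c i.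
have vI : injective v.
  by move=> i j /eqP; rewrite nth_uniq // => /eqP/ord_inj.
have vS i : exists e, joins e (v i) (v (ordS i)).
  apply/existsP; rewrite -/(adj _ _).
  by have := next_cycle cc (mem_nth x0 (ltn_ord i)); rewrite next_nth_modn.
have [e eP] := choice vS.
split; first by lia.
exists v, e; split=> // i j ij; have := eP j; rewrite -ij.
(* If [i] and [j] differ, each is the cyclic successor of the other, so the size is at most 2. *)
move=> /(joins_inj (eP i))[[/vI-> //]|[/vI jE /vI]].
rewrite jE => /(congr1 val) /= iE; have := ltn_ord i.
rewrite leq_eqVlt => /orP[/eqP i1|i1]; move: iE.
  by rewrite i1 modnn modn_small; lia.
rewrite (modn_small i1); move: i1; rewrite leq_eqVlt => /orP[/eqP i2|i2].
  by rewrite i2 modnn; lia.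
by rewrite modn_small //; lia.
Qed.

Lemma adj_join (p : position) (u v x y : p) :
  adj x y -> @adj (join u v) (Some x) (Some y).
Proof.
case/existsP => e; rewrite /joins /= => he; apply/existsP; exists (inl e).
by move: he; rewrite /joins /= => /orP[]/eqP->; rewrite eqxx ?orbT.
Qed.

Lemma connect_join (p : position) (u v x y : p) :
  connect (@adj p) x y -> connect (@adj (join u v)) (Some x) (Some y).
Proof.
case/connectP => s ps ->; apply/connectP; exists (map Some s); last first.
  by rewrite last_map.
by rewrite path_map; apply: sub_path ps => a b; exact: adj_join.
Qed.

Lemma adj_join_l (p : position) (u v : p) : @adj (join u v) (Some u) None.
Proof. by apply/existsP; exists (inr true); rewrite /joins /= eqxx. Qed.

Lemma adj_join_r (p : position) (u v : p) : @adj (join u v) (Some v) None.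
Proof. by apply/existsP; exists (inr false); rewrite /joins /= eqxx. Qed.

(** A simple path from [u] to [v] closes up through the new vertex; if it is empty, the two halves
    of the curve are parallel edges. *)
Lemma join_has_cycle (p : position) (u v : p) :
  connect (@adj p) u v -> exists k, has_cycle (join u v) k.
Proof.
case/connectP => s0 ps0 vE; case: (shortenP ps0) vE => s ps us _ vE {s0 ps0}.
have [s0|sn0] := eqVneq s [::].
  exists 2; split=> //.
  exists (fun i => if i == ord0 then None else Some u),
    (fun i => inr (i == ord0)).
  rewrite s0 /= in vE; subst v; split.
  - by case=> [[|[|//]] i] [[|[|//]] j] //= _; exact/val_inj.
  - by case=> [[|[|//]] i] [[|[|//]] j] //= _; exact/val_inj.
  - by case=> [[|[|//]] i]; rewrite /joins /= eqxx ?orbT.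
exists (size (None :: map Some (u :: s) : seq (join u v))).
apply: ucycle_has_cycle; first by rewrite /= size_map; case: s sn0 {ps us vE}.
apply/andP; split.
  rewrite /= adj_sym adj_join_l rcons_path last_map -vE adj_join_r andbT.
  rewrite path_map.
  by apply: sub_path ps => a b; exact: adj_join.
rewrite cons_uniq map_inj_uniq ?us ?andbT; last by move=> ? ? [].
by apply/mapP => -[].
Qed.

(* c x is the name of the component of x. *)
Record is_forest_after (n k : nat) (p : position) (c : p -> 'I_n) : Prop :=
    IsForestAfter {
  forest_card : #|p| = (n + k)%N;
  forest_comp : (#|[set c x | x in p]%SET| + k = n)%N;
  forest_edge : forall (e : edge p) x y, joins e x y -> c x = c y;
  forest_connect : forall x y, c x = c y -> connect (@adj p) x y;
  forest_tip : forall x, exists2 y, c y = c x & (0 < tips y)%N;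
  forest_rooted : forall r : p, rooted r
}.

(** * Preservation of the forest invariant along a play *)

Lemma forest_spots n (t : 'I_n -> nat) : (forall i, 0 < t i)%N ->
  @is_forest_after n 0 (spots t) id.
Proof.
move=> t0; split=> //=.
- by rewrite card_ord addn0.
- by rewrite addn0 card_imset ?card_ord.
- by move=> x y ->; exact: connect0.
- by move=> x; exists x.
- by move=> r; exists (fun=> 0), (of_void _), (of_void _); split=> -[].
Qed.

(** The component of [v] and the new vertex take the name [c u]. *)
Lemma forest_join n k (p : position) (c : p -> 'I_n) (u v : p) :
  is_forest_after k c -> c u != c v ->
  exists c', @is_forest_after n k.+1 (join u v) c'.
Proof.
move=> [pk ck ce cc ct rt] uv.
pose c' (x : join u v) : 'I_n :=
  if x is Some x then if c x == c v then c u else c x else c u.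
exists c'; split.
- by rewrite card_option pk addnS.
(* Exactly the name [c v] disappears. *)
- apply: etrans ck; rewrite addnS -addSn; congr addn.
  rewrite [RHS](cardsD1 (c v)) imset_f // add1n; congr _.+1.
  apply: eq_card => i; rewrite !inE; apply/imsetP/andP.
    move=> [[x|] _ ->] /=; last by rewrite uv imset_f.
    by case: ifPn => [_|->]; rewrite ?uv imset_f.
  move=> [iv /imsetP[x _ iE]]; exists (Some x) => //=.
  by rewrite -iE (negbTE iv).
- have edge_eq : forall e : edge (join u v), c' (ends e).1 = c' (ends e).2.
    move=> [e|[]] /=; rewrite ?eqxx ?if_same //.
    by rewrite (ce _ _ _ (joins_ends e)).
  by move=> e x y /(joins_inj (joins_ends e))[[-> ->]|[-> ->]].
(* Every vertex of the merged component reaches [None] through [u] or [v]. *)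
- have toN x : c' (Some x) = c u -> connect (@adj (join u v)) (Some x) None.
    have uN := connect1 (adj_join_l u v); have vN := connect1 (adj_join_r u v).
    rewrite /=; case: ifP => [/eqP/cc xv _|_ /cc xu].
      exact: connect_trans (connect_join u v xv) vN.
    exact: connect_trans (connect_join u v xu) uN.
  move=> [x|] [y|] E; last exact: connect0; last 1 first.
  + by rewrite connect_adjC; apply: toN.
  + have [xu|xu] := eqVneq (c' (Some x)) (c u).
      apply: connect_trans (toN _ xu) _.
      by rewrite connect_adjC; apply: toN; rewrite -E.
    apply/connect_join/cc; move: E xu => /=.
    case: (eqVneq (c x) (c v)) => [_ _|_]; first by rewrite eqxx.
    by case: ifP => // _ ->; rewrite eqxx.
  + exact: toN.
(* The new vertex supplies a tip to the merged component; the other components lose none. *)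
- move=> x; have [->|] := eqVneq (c' x) (c u); first by exists None.
  case: x => [x|]; rewrite /= ?eqxx //.
  case: ifP => [|xv xu]; first by rewrite eqxx.
  have [y yx y0] := ct x; exists (Some y); first by rewrite /= yx xv.
  rewrite /= /tips_used; case: eqVneq => [yu|_].
    by rewrite -yx yu eqxx in xu.
  by case: eqVneq => [yv|_]; [rewrite -yx yv eqxx in xv|rewrite subn0].
- apply: (@rooted_join p u v [pred x | c x == c u]) => //.
  + by move=> e a b /ce; rewrite !inE => ->.
  + by rewrite inE.
  + by rewrite inE eq_sym.
Qed.

(** There are [n - k] components, and at least one since there is a vertex. *)
Lemma forest_moves_lt n k (p : position) (c : p -> 'I_n) :
  (0 < n)%N -> is_forest_after k c -> (k < n)%N.
Proof.
move=> n0 fc; have /card_gt0P[x _] : (0 < #|p|)%N.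
  by rewrite (forest_card fc) ltn_addr.
have : (0 < #|[set c x | x in p]%SET|)%N.
  by apply/card_gt0P; exists (c x); exact: imset_f.
have := forest_comp fc; lia.
Qed.

Theorem theorem3p1 (R : realType) (n : nat) (t : 'I_n -> nat) (g : nat)
    (n_gt0 : (0 < n)%N) (t_gt0 : forall i, (0 < t i)%N)
    (g_ge : (2 * n + 1 <= g)%N) :
  ends_after (BS (P_ R g) t) (n - 1)%N.
Proof.
have inv k p : @play (BS (P_ R g) t) k p ->
    exists c : p -> 'I_n, is_forest_after k c.
  elim=> [|{}k {}p q _ [c fc] [u [v [_ -> [_ gq]]]]].
    by exists id; exact: forest_spots.
  apply: (forest_join fc); apply/eqP => /(forest_connect fc).
  case/join_has_cycle => l lc.
  (* After the move there are [n + k + 1] vertices, at most [2 * n] since [k < n]. *)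
  have := has_cycle_leq lc; rewrite card_option (forest_card fc).
  have : (g <= l)%N.
    rewrite -(ler_nat R) -lee_fin; apply: le_trans gq _.
    by apply: ereal_inf_lbound; exists l.
  have := forest_moves_lt n_gt0 fc; lia.
split=> k p /inv[c fc]; have kn := forest_moves_lt n_gt0 fc; first by lia.
(* If [k < n - 1], at least two components remain, and tips from two of them can be joined. *)
move=> tp; apply/eqP; apply/negPn/negP => kn1.
have : (1 < #|[set c x | x in p]%SET|)%N.
  have := forest_comp fc; lia.
case/card_gt1P => _ [_ [/imsetP[x _ ->] /imsetP[y _ ->] xy]].
have [u uE u0] := forest_tip fc x.
have [v vE v0] := forest_tip fc y.
have uv : c u != c v by rewrite uE vE.
have [c' fc'] := forest_join fc uv.
apply: (tp (join u v)); exists u, v; split=> //.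
  (* As [u] and [v] are distinct, the curve uses one tip at each. *)
  move=> z; rewrite /tips_used.
  have [->|_] := eqVneq z u; last by case: eqVneq => [->|].
  by move: uv; have [->|_ _] := eqVneq u v; rewrite ?eqxx ?addn0.
exact: rooted_mem (forest_rooted fc' None).
Qed.
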